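(* Let $a,b\in\mathbb{C}$ with $a\neq 0$, $a\neq 1$, $b\neq 1$, $a\neq b$, and put $$C_{13}(a,b)=a^4-a^3b+a^2b-a^2+b^2-2ab+2a-b .$$ Consider the following 13 lines in $\mathbb{P}^2(\mathbb{C})$ with homogeneous coordinates $(x:y:z)$: $\ell_{1}: z-y=0$; $\ell_{2}: z=0$; $\ell_{3}: y=0$; $\ell_{4}: z-x=0$; $\ell_{5}: y-x=0$; $\ell_{6}: ay-x=0$; $\ell_{7}: x-az=0$; $\ell_{8}: -x+ay+(b-a)z=0$; $\ell_{9}: x+(a-b)y-az=0$; $\ell_{10}: x-(b-a)y+(ab-a^2-a)z=0$; $\ell_{11}: x+(ab-a^2-a)y-(b-a)z=0$; $\ell_{12}: -ax+ay+(b-1)z=0$; $\ell_{13}: -ax+(b-1)y+az=0$. (1) The two triples of lines $\{\ell_1,\ell_{10},\ell_{11}\}$ and $\{\ell_1,\ell_{12},\ell_{13}\}$ are each concurrent for all such $a,b$. Each of the four triples of lines $\{\ell_8,\ell_{10},\ell_{13}\}$, $\{\ell_7,\ell_{13},\ell_{11}\}$, $\{\ell_9,\ell_{12},\ell_{11}\}$, $\{\ell_{12},\ell_{10},\ell_6\}$ is concurrent if and only if $C_{13}(a,b)=0$. (2) If $C_{13}(a,b)=0$, then the 13 lines are pairwise distinct and they have exactly 22 triple points, of which six lie on the line $\ell_1$ and five lie on each of the other 12 lines.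
   Context: Three lines are called concurrent if they have a common point. A triple point of a finite set of lines is a point lying on exactly three of the lines. *)

(* Defs.v *)
From HB Require Import structures.
From mathcomp Require Import all_boot all_order all_algebra.
From mathcomp Require Import mathcomp_extra boolp classical_sets functions.
From mathcomp Require Import cardinality reals.
From mathcomp Require Import complex.

Set Implicit Arguments.
Unset Strict Implicit.
Unset Printing Implicit Defensive.

Import Order.TTheory GRing.Theory Num.Theory.
Local Open Scope classical_set_scope.
Local Open Scope card_scope.
Local Open Scope ring_scope.

(* The projective plane over F: its points are the lines through the origin
   of F^3, so that the point (x : y : z) is the span of the row (x, y, z). *)
Definition P2 (F : fieldType) : Type :=
  {U : {vspace 'rV[F]_3} | (\dim U == 1)%N}.

(* For a homogeneous e, it does not matter which homogeneous coordinates of the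
   point are used; the zero vector imposes no condition. *)
Definition locus (F : fieldType) (e : F -> F -> F -> F) : set (P2 F) :=
  [set P : P2 F | forall v : 'rV[F]_3, v \in val P ->
           e (v ord0 (inord 0)) (v ord0 (inord 1)) (v ord0 (inord 2)) = 0].

Definition concurrent (F : fieldType) (l m n : set (P2 F)) : Prop :=
  l `&` m `&` n !=set0.

Definition triple_points (F : fieldType) (L : set (set (P2 F))) : set (P2 F) :=
  [set P | [set l | L l /\ l P] #= `I_3].

(* Only the indices 1, ..., 13 are meaningful. *)
Definition ell_eq (F : fieldType) (a b : F) (k : nat) (x y z : F) : F :=
  match k with
  | 1  => z - y
  | 2  => z
  | 3  => y
  | 4  => z - x
  | 5  => y - x
  | 6  => a * y - x
  | 7  => x - a * z
  | 8  => - x + a * y + (b - a) * z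
  | 9  => x + (a - b) * y - a * z
  | 10 => x - (b - a) * y + (a * b - a ^+ 2 - a) * z
  | 11 => x + (a * b - a ^+ 2 - a) * y - (b - a) * z
  | 12 => - a * x + a * y + (b - 1) * z
  | 13 => - a * x + (b - 1) * y + a * z
  | _  => 0
  end.

Definition ell (F : fieldType) (a b : F) (k : nat) : set (P2 F) :=
  locus (ell_eq a b k).

Definition arrangement (F : fieldType) (a b : F) : set (set (P2 F)) :=
  [set ell a b k | k in [set k : nat | (1 <= k <= 13)%N]].

Definition C13 (F : fieldType) (a b : F) : F :=
  a ^+ 4 - a ^+ 3 * b + a ^+ 2 * b - a ^+ 2 + b ^+ 2 - 2 * a * b + 2 * a - b.

(* Main.v *)
Require Import Defs.
From HB Require Import structures.
From mathcomp Require Import all_boot all_order all_algebra.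
From mathcomp Require Import mathcomp_extra boolp classical_sets functions.
From mathcomp Require Import cardinality reals.
From mathcomp Require Import complex.
From mathcomp Require Import ring.

Set Implicit Arguments.
Unset Strict Implicit.
Unset Printing Implicit Defensive.

Import Order.TTheory GRing.Theory Num.Theory.
Local Open Scope classical_set_scope.
Local Open Scope card_scope.
Local Open Scope ring_scope.

(** Three lines are concurrent iff the 3x3 determinant of their coefficients
    vanishes, and each of the four determinants of part (1) is C13 up to sign.
    Since C13 is monic of degree 2 in b, every determinant reduces modulo C13 to
    some p(a) + q(a) b, of norm p^2 + p q tr + q^2 nm when b^2 = tr b - nm.  For the
    286 triples of lines, either the determinant reduces to 0 (22 triples), or
    its norm is +-a^i (a - 1)^j, so that it vanishes nowhere on the curve when a
    is neither 0 nor 1.  This finite computation determines which triples are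
    concurrent; the rest is combinatorial: mapping a triple point to the list of
    lines through it is a bijection onto the 22 triples, because no line off such
    a triple is concurrent with its first two lines. *)

(** * Linear forms on F^3, points as lines of vectors, and the determinant criterion for
    concurrency *)

Section Forms.
Variable F : fieldType.
Implicit Types (u v w : F * F * F) (P Q : P2 F).

Definition linear_form u (x y z : F) : F := u.1.1 * x + u.1.2 * y + u.2 * z.

Definition form_at u (r : 'rV[F]_3) : F :=
  linear_form u (r ord0 (inord 0)) (r ord0 (inord 1)) (r ord0 (inord 2)).

Definition det3 u v w : F :=
  u.1.1 * (v.1.2 * w.2 - v.2 * w.1.2) + u.1.2 * (v.2 * w.1.1 - v.1.1 * w.2)
  + u.2 * (v.1.1 * w.1.2 - v.1.2 * w.1.1).

Lemma form_atZ u c r : form_at u (c *: r) = c * form_at u r.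
Proof. by rewrite /form_at /linear_form !mxE; ring. Qed.

Lemma form_atB u r s : form_at u (r - s) = form_at u r - form_at u s.
Proof. by rewrite /form_at /linear_form !mxE; ring. Qed.

Lemma eq_locus (e e' : F -> F -> F -> F) :
  (forall x y z, e x y z = e' x y z) -> locus e = locus e'.
Proof.
by move=> ee'; congr locus; do 3![apply/funext => ?].
Qed.

Lemma P2_vline P : exists2 r, r != 0 & val P = <[r]>%VS.
Proof.
case: P => U /= dimU; exists (vpick U).
  by rewrite vpick0 -dimv_eq0 (eqP dimU).
apply/esym/eqP; rewrite eqEdim -memvE memv_pick (eqP dimU) dim_vline.
by rewrite vpick0 -dimv_eq0 (eqP dimU).
Qed.

Lemma vline_P2 (r : 'rV[F]_3) : r != 0 -> exists P, val P = <[r]>%VS.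
Proof.
by move=> r0; have dimr : (\dim <[r]> == 1)%N; [rewrite dim_vline r0|exists (exist _ <[r]>%VS dimr)].
Qed.

Lemma locus_vline u P r :
  val P = <[r]>%VS -> locus (linear_form u) P <-> form_at u r = 0.
Proof.
move=> Pr; split=> [|ur0 s]; first by apply; rewrite Pr memv_line.
by rewrite Pr => /vlineP[c ->]; rewrite -/(form_at u _) form_atZ ur0 mulr0.
Qed.

Lemma det3_eq0P u v w :
  det3 u v w = 0 <->
  exists2 r, r != 0 & [/\ form_at u r = 0, form_at v r = 0 & form_at w r = 0].
Proof.
(* The forms are the columns of M, since [det0P] yields a row vector killed by right multiplication
   by M: here, coordinates of a common point. *)
pose M := \matrix_(i < 3, j < 3)
  let t := nth 0 [:: u; v; w] j in nth 0 [:: t.1.1; t.1.2; t.2] i.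
have detM : \det M = det3 u v w.
  rewrite (expand_det_row _ ord0) !big_ord_recl big_ord0 /cofactor.
  rewrite !(expand_det_row _ ord0) !big_ord_recl !big_ord0 /cofactor !det_mx11.
  by rewrite !mxE /= /det3; ring.
have mulM (r : 'rV_3) :
    r *m M = \row_j form_at (nth 0 [:: u; v; w] j) r.
  apply/rowP => j; rewrite !mxE !big_ord_recl big_ord0 !mxE /=.
  rewrite /form_at /linear_form.
  have -> : inord 0 = ord0 :> 'I_3 by apply/val_inj; rewrite /= inordK.
  have -> : inord 1 = lift ord0 ord0 :> 'I_3 by apply/val_inj; rewrite /= inordK.
  have -> : inord 2 = lift ord0 (lift ord0 ord0) :> 'I_3.
    by apply/val_inj; rewrite /= inordK.
  by ring.
rewrite -detM; split=> [/eqP/det0P[r r0]|[r r0 [ru rv rw]]].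
  rewrite mulM => /rowP rM; exists r => //.
  by split; [move: (rM ord0)|move: (rM (inord 1))|move: (rM (inord 2))];
    rewrite !mxE ?inordK.
apply/eqP/det0P; exists r => //; rewrite mulM; apply/rowP => j; rewrite !mxE.
by case: j => -[|[|[|]]].
Qed.

Lemma concurrentP u v w :
  concurrent (locus (linear_form u)) (locus (linear_form v))
    (locus (linear_form w)) <-> det3 u v w = 0.
Proof.
rewrite det3_eq0P; split=> [[P [[uP vP] wP]]|[r r0 [ur vr wr]]].
  have [r r0 Pr] := P2_vline P; exists r => //.
  by split; apply/(locus_vline _ Pr).
have [P Pr] := vline_P2 r0; exists P.
by split; [split|]; apply/(locus_vline _ Pr).
Qed.

(** Only the zero vector is killed by all three forms. If r and s span P and Q, then w(r) s - w(s) r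
    is killed by u, v and w, so it is 0; as w(r) is nonzero, s is a multiple of r. *)
Lemma locus_meet_unique u v w P Q : det3 u v w != 0 ->
  locus (linear_form u) P -> locus (linear_form v) P ->
  locus (linear_form u) Q -> locus (linear_form v) Q -> P = Q.
Proof.
have [r r0 Pr] := P2_vline P; have [s s0 Qs] := P2_vline Q => d0.
move=> /(locus_vline _ Pr) ur /(locus_vline _ Pr) vr.
move=> /(locus_vline _ Qs) us /(locus_vline _ Qs) vs.
have trivial_zero t : form_at u t = 0 -> form_at v t = 0 -> form_at w t = 0 -> t = 0.
  move=> ut vt wt; apply/eqP; apply: contraNT d0 => t0.
  by apply/eqP/det3_eq0P; exists t.
have wr0 : form_at w r != 0.
  by apply: contraNneq r0 => wr; rewrite (trivial_zero r).
have /eqP : form_at w r *: s - form_at w s *: r = 0.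
  apply: trivial_zero; rewrite form_atB !form_atZ ?ur ?us ?vr ?vs ?mulr0 ?subr0 //.
  by rewrite mulrC subrr.
rewrite subr_eq0 => /eqP rs; apply/val_inj; rewrite Pr Qs.
apply/eqP; rewrite eq_sym eqEdim !dim_vline r0 s0 leqnn andbT -memvE.
apply/vlineP; exists ((form_at w r)^-1 * form_at w s).
by rewrite -scalerA -rs scalerA mulVf ?scale1r.
Qed.

End Forms.

(** * Computable arithmetic in Z[a, b] / (C13) *)

(* Coefficients of a polynomial in a, constant term first. *)
Definition zpoly := seq int.

Fixpoint zp_add (p q : zpoly) : zpoly :=
  match p, q with
  | c :: p', d :: q' => c + d :: zp_add p' q'
  | [::], _ => q
  | _, [::] => p
  end.

Definition zp_scale (c : int) (p : zpoly) : zpoly := [seq c * d | d <- p].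

Fixpoint zp_mul (p q : zpoly) : zpoly :=
  if p is c :: p' then zp_add (zp_scale c q) (0 :: zp_mul p' q) else [::].

(** Synthetic division by a - 1, giving quotient and remainder. The quotient of a nonempty list ends
    with a 0, so constants have to be recognised up to trailing zeros. *)
Fixpoint zp_divX1 (p : zpoly) : zpoly * int :=
  if p is c :: p' then
    let: (q, r) := zp_divX1 p' in (r :: q, r + c)
  else ([::], 0).

Definition zp_zero : pred zpoly := all (pred1 0).

(* Tests whether p is +-a^i (a - 1)^j; n is fuel. *)
Fixpoint zp_unit (n : nat) (p : zpoly) : bool :=
  if n is n'.+1 then
    if p is c :: p' then
      if c == 0 then zp_unit n' p' else
      if zp_zero p' then (c == 1) || (c == -1) else
      let: (q, r) := zp_divX1 p in (r == 0) && zp_unit n' q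
    else false
  else false.

(* The pair (p, q) stands for p(a) + q(a) b in Z[a, b] / (C13), where
   b^2 = zp_trace b - zp_norm. *)
Definition elt := (zpoly * zpoly)%type.

(** Sum and product of the two roots of [C13] as a quadratic in b. *)
Definition zp_trace : zpoly := [:: 1; 2; -1; 1].
Definition zp_norm : zpoly := [:: 0; 2; -1; 0; 1].

Definition elt_add (f g : elt) : elt := (zp_add f.1 g.1, zp_add f.2 g.2).

Definition elt_sub (f g : elt) : elt :=
  (zp_add f.1 (zp_scale (-1) g.1), zp_add f.2 (zp_scale (-1) g.2)).

Definition elt_mul (f g : elt) : elt :=
  let h := zp_mul f.2 g.2 in
  (zp_add (zp_mul f.1 g.1) (zp_scale (-1) (zp_mul h zp_norm)),
   zp_add (zp_add (zp_mul f.1 g.2) (zp_mul f.2 g.1)) (zp_mul h zp_trace)).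

(* Product of f and its conjugate, b being sent to zp_trace - b. *)
Definition elt_norm (f : elt) : zpoly :=
  zp_add (zp_mul f.1 f.1)
    (zp_add (zp_mul (zp_mul f.1 f.2) zp_trace)
            (zp_mul (zp_mul f.2 f.2) zp_norm)).

Definition elt_det3 (u v w : elt * elt * elt) : elt :=
  let cross x y z t := elt_sub (elt_mul x t) (elt_mul y z) in
  elt_add
    (elt_add (elt_mul u.1.1 (cross v.1.2 v.2 w.1.2 w.2))
             (elt_mul u.1.2 (cross v.2 v.1.1 w.2 w.1.1)))
    (elt_mul u.2 (cross v.1.1 v.1.2 w.1.1 w.1.2)).

Definition elt_line (k : nat) : elt * elt * elt :=
  let c (n : int) : elt := ([:: n], [::]) in
  match k with
  | 1 => (c 0, c (-1), c 1)
  | 2 => (c 0, c 0, c 1)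
  | 3 => (c 0, c 1, c 0)
  | 4 => (c (-1), c 0, c 1)
  | 5 => (c (-1), c 1, c 0)
  | 6 => (c (-1), ([:: 0; 1], [::]), c 0)
  | 7 => (c 1, c 0, ([:: 0; -1], [::]))
  | 8 => (c (-1), ([:: 0; 1], [::]), ([:: 0; -1], [:: 1]))
  | 9 => (c 1, ([:: 0; 1], [:: -1]), ([:: 0; -1], [::]))
  | 10 => (c 1, ([:: 0; 1], [:: -1]), ([:: 0; -1; -1], [:: 0; 1]))
  | 11 => (c 1, ([:: 0; -1; -1], [:: 0; 1]), ([:: 0; 1], [:: -1]))
  | 12 => (([:: 0; -1], [::]), ([:: 0; 1], [::]), ([:: -1], [:: 1]))
  | 13 => (([:: 0; -1], [::]), ([:: -1], [:: 1]), ([:: 0; 1], [::]))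
  | _ => (c 0, c 0, c 0)
  end.

(* Reduced modulo C13: it represents the determinant only on the curve. *)
Definition det_lines (i j k : nat) : elt :=
  elt_det3 (elt_line i) (elt_line j) (elt_line k).

Definition coll (i j k : nat) : bool :=
  let d := det_lines i j k in zp_zero d.1 && zp_zero d.2.

(** * The finite computation on the 13 lines *)

Definition lines : seq nat := iota 1 13.

Definition triples : seq (seq nat) :=
  [:: [:: 1; 2; 3]; [:: 1; 4; 5]; [:: 1; 6; 7]; [:: 1; 8; 9]; [:: 1; 10; 11];
      [:: 1; 12; 13]; [:: 2; 4; 7]; [:: 2; 5; 12]; [:: 2; 6; 8]; [:: 2; 9; 10];
      [:: 3; 4; 13]; [:: 3; 5; 6]; [:: 3; 7; 9]; [:: 3; 8; 11]; [:: 4; 6; 11];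
      [:: 4; 8; 12]; [:: 5; 7; 10]; [:: 5; 9; 13]; [:: 6; 10; 12];
      [:: 7; 11; 13]; [:: 8; 10; 13]; [:: 9; 11; 12]]%N.

Lemma det_lines_dichotomy :
  all (fun i => all (fun j => all (fun k =>
    [|| i == j, i == k, j == k, coll i j k
      | zp_unit 40 (elt_norm (det_lines i j k))]) lines) lines) lines.
Proof. by vm_compute. Qed.

Lemma coll_triples :
  all (fun i => all (fun j => all (fun k =>
    (i < j < k)%N ==> (coll i j k == ([:: i; j; k] \in triples))) lines) lines)
    lines.
Proof. by vm_compute. Qed.

(** Keeps the multiplicity at exactly three: a fourth line through the point would be concurrent
    with the first two. *)
Lemma triples_no_fourth :
  all (fun t => all (fun l =>
    (l \in t) || ~~ coll (nth 0%N t 0) (nth 0%N t 1) l) lines) triples.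
Proof. by vm_compute. Qed.

(** The third line certifies that the forms of lines i and j are independent, which gives both
    distinct lines and a unique meeting point. *)
Lemma exists_noncoll :
  all (fun i => all (fun j => (i == j) ||
    has (fun k => [&& k != i, k != j & ~~ coll i j k]) lines) lines) lines.
Proof. by vm_compute. Qed.

(** The filter condition puts each triple in the shape of [lines_through], so that the two can be
    compared as lists. *)
Lemma triples_wf :
  all (fun t => if t is [:: i; j; k] then
    [&& i \in lines, j \in lines, k \in lines, (i < j < k)%N
      & [seq l <- lines | l \in t] == t]
    else false) triples.
Proof. by vm_compute. Qed.

(** * The 13 lines as zero sets of linear forms *)

Section EllForm.
Variables (F : fieldType) (a b : F).

Definition ell_form (k : nat) : F * F * F :=
  (ell_eq a b k 1 0 0, ell_eq a b k 0 1 0, ell_eq a b k 0 0 1).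

Lemma ell_linear_form k : ell a b k = locus (linear_form (ell_form k)).
Proof.
apply: eq_locus => x y z; rewrite /linear_form.
by do 14?[case: k => [|k]] => /=; ring.
Qed.

Lemma concurrent_ell i j k :
  concurrent (ell a b i) (ell a b j) (ell a b k) <->
  det3 (ell_form i) (ell_form j) (ell_form k) = 0.
Proof. by rewrite !ell_linear_form; exact: concurrentP. Qed.

End EllForm.

(** * Soundness of the computation: evaluation at a point (a, b) of the curve *)

Section Evaluation.
Variables (F : fieldType) (a b : F).

Fixpoint zp_eval (p : zpoly) : F :=
  if p is c :: p' then c%:~R + a * zp_eval p' else 0.

Definition elt_eval (f : elt) : F := zp_eval f.1 + zp_eval f.2 * b.

Lemma zp_evalD p q : zp_eval (zp_add p q) = zp_eval p + zp_eval q.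
Proof.
elim: p q => [|c p IH] [|d q] /=; rewrite ?add0r ?addr0 //.
by rewrite IH rmorphD; ring.
Qed.

Lemma zp_evalZ c p : zp_eval (zp_scale c p) = c%:~R * zp_eval p.
Proof. by elim: p => [|d p IH] /=; rewrite ?mulr0 // IH rmorphM; ring. Qed.

Lemma zp_evalM p q : zp_eval (zp_mul p q) = zp_eval p * zp_eval q.
Proof.
elim: p => [|c p IH] /=; rewrite ?mul0r //.
by rewrite zp_evalD zp_evalZ /= IH; ring.
Qed.

Lemma zp_zero_eval p : zp_zero p -> zp_eval p = 0.
Proof. by elim: p => //= c p IH /andP[/eqP -> /IH ->]; ring. Qed.

Lemma zp_eval_divX1 p :
  zp_eval p = (a - 1) * zp_eval (zp_divX1 p).1 + (zp_divX1 p).2%:~R.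
Proof.
elim: p => [|c p /=]; first by rewrite /= mulr0 addr0.
by case: (zp_divX1 p) => q r /= ->; rewrite rmorphD; ring.
Qed.

(** A product of nonzero factors a and a - 1 and a constant 1 or -1, which is nonzero in every
    characteristic. *)
Lemma zp_unit_eval n p : a != 0 -> a != 1 -> zp_unit n p -> zp_eval p != 0.
Proof.
move=> a0 a1; elim: n p => //= n IH [//|c p].
have [->|c0] := eqVneq c 0; first by move=> /IH p0; rewrite /= add0r mulf_neq0.
case: ifP => [/zp_zero_eval p0|_].
  rewrite /= p0 mulr0 addr0 => /orP[] /eqP ->; last rewrite rmorphN oppr_eq0.
    exact: oner_neq0.
  exact: oner_neq0.
rewrite zp_eval_divX1; case: (zp_divX1 _) => q r /= /andP[/eqP -> /IH q0].
by rewrite addr0 mulf_neq0 // subr_eq0.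
Qed.

Lemma elt_evalD f g : elt_eval (elt_add f g) = elt_eval f + elt_eval g.
Proof. by rewrite /elt_eval !zp_evalD; ring. Qed.

Lemma elt_evalB f g : elt_eval (elt_sub f g) = elt_eval f - elt_eval g.
Proof. by rewrite /elt_eval !zp_evalD !zp_evalZ; ring. Qed.

Lemma elt_line_eval k :
  (elt_eval (elt_line k).1.1, elt_eval (elt_line k).1.2,
   elt_eval (elt_line k).2) = ell_form a b k.
Proof.
by do 14?[case: k => [|k]]; congr ((_, _), _); rewrite /elt_eval /=; ring.
Qed.

Hypothesis hC : C13 a b = 0.

Lemma zp_trace_norm : b ^+ 2 = zp_eval zp_trace * b - zp_eval zp_norm.
Proof.
by apply/eqP; rewrite -subr_eq0 -hC; apply/eqP; rewrite /C13 /=; ring.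
Qed.

Lemma elt_evalM f g : elt_eval (elt_mul f g) = elt_eval f * elt_eval g.
Proof.
rewrite /elt_eval /elt_mul; move: (zp_mul _ _) (zp_evalM f.2 g.2) => h hE.
cbn [fst snd].
rewrite !(zp_evalD, zp_evalZ, zp_evalM).
(* Isolates b^2, so that the equation of the curve can be substituted. *)
transitivity (zp_eval f.1 * zp_eval g.1
  + (zp_eval f.1 * zp_eval g.2 + zp_eval f.2 * zp_eval g.1) * b
  + zp_eval f.2 * zp_eval g.2 * b ^+ 2); last by ring.
by rewrite zp_trace_norm hE; ring.
Qed.

(** For f = p + q b, substituting p = - q b turns the norm into q^2 (b^2 - tr b + nm), which is 0 on
    the curve. *)
Lemma elt_norm_eval f : elt_eval f = 0 -> zp_eval (elt_norm f) = 0.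
Proof.
rewrite /elt_eval => /eqP; rewrite addr_eq0 => /eqP fb.
rewrite /elt_norm !(zp_evalD, zp_evalM) fb.
transitivity (zp_eval f.2 ^+ 2
  * (b ^+ 2 - (zp_eval zp_trace * b - zp_eval zp_norm))); first by ring.
by rewrite -zp_trace_norm subrr mulr0.
Qed.

Lemma det_lines_eval i j k : elt_eval (det_lines i j k) =
  det3 (ell_form a b i) (ell_form a b j) (ell_form a b k).
Proof.
rewrite /det_lines /elt_det3 !(elt_evalD, elt_evalM, elt_evalB).
by rewrite -!elt_line_eval.
Qed.

Lemma det_lines_eq0 i j k : a != 0 -> a != 1 ->
  i \in lines -> j \in lines -> k \in lines -> i != j -> i != k -> j != k ->
  det3 (ell_form a b i) (ell_form a b j) (ell_form a b k) = 0 <-> coll i j k.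
Proof.
move=> a0 a1 il jl kl /negPf ij /negPf ik /negPf jk; rewrite -det_lines_eval.
have := allP (allP (allP det_lines_dichotomy i il) j jl) k kl.
rewrite ij ik jk !orFb => /orP H; split=> [d0|/andP[d1 d2]].
  case: H => [->//|/(zp_unit_eval a0 a1)].
  by rewrite elt_norm_eval ?eqxx.
by rewrite /elt_eval !zp_zero_eval // mul0r addr0.
Qed.

End Evaluation.

Lemma card_seq (T : eqType) (s : seq T) : uniq s -> [set` s] #= `I_(size s).
Proof.
(* The empty list is treated apart because [nth] needs a default element. *)
case: s => [_|x s us]; first by apply/card_eqP; rewrite set_nil II0; exact/card_eqP.
have -> : [set` x :: s] = nth x (x :: s) @` `I_(size (x :: s)).
  apply/seteqP; split=> [y /= ys|_ [n /= ns <-]]; last exact: mem_nth.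
  by exists (index y (x :: s)); [move: ys; rewrite -index_mem|exact: nth_index].
apply: inj_card_eq => i j; rewrite !inE /= => il jl /eqP.
by rewrite nth_uniq // => /eqP.
Qed.

(** * Incidences on the curve: triple points and the lines through them *)

Section Incidence.
Variables (F : fieldType) (a b : F).
Hypotheses (a0 : a != 0) (a1 : a != 1) (hC : C13 a b = 0).

Lemma concurrent_coll i j k : i \in lines -> j \in lines -> k \in lines ->
  i != j -> i != k -> j != k ->
  concurrent (ell a b i) (ell a b j) (ell a b k) <-> coll i j k.
Proof. by move=> *; rewrite concurrent_ell det_lines_eq0. Qed.

Lemma exists_det3_neq0 i j : i \in lines -> j \in lines -> i != j ->
  exists k, det3 (ell_form a b i) (ell_form a b j) (ell_form a b k) != 0.
Proof.
move=> il jl ij; have := allP (allP exists_noncoll i il) j jl.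
rewrite (negPf ij) orFb => /hasP[k kl /and3P[ki kj nc]]; exists k.
apply/eqP; rewrite (det_lines_eq0 hC) //; first by rewrite (negPf nc).
  by rewrite eq_sym.
by rewrite eq_sym.
Qed.

Lemma ell_neq i j : i \in lines -> j \in lines -> i != j ->
  ell a b i <> ell a b j.
Proof.
move=> il jl ij eq_ij; have [k /eqP] := exists_det3_neq0 il jl ij.
(* Were the lines equal, concurrency of i, j, k would be that of i, i, k, whose determinant has a
   repeated form. *)
rewrite -concurrent_ell -eq_ij concurrent_ell; apply.
by rewrite /det3; ring.
Qed.

Lemma ell_meet_unique i j P Q : i \in lines -> j \in lines -> i != j ->
  ell a b i P -> ell a b j P -> ell a b i Q -> ell a b j Q -> P = Q.
Proof.
move=> il jl ij; have [k d0] := exists_det3_neq0 il jl ij.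
by rewrite !ell_linear_form; exact: locus_meet_unique d0.
Qed.

Definition lines_through (P : P2 F) : seq nat :=
  [seq k <- lines | `[< ell a b k P >]].

Lemma mem_lines_through P k :
  k \in lines -> (k \in lines_through P) = `[< ell a b k P >].
Proof. by move=> kl; rewrite mem_filter kl andbT. Qed.

(** Triple points count lines as sets, [lines_through] counts indices; the counts agree because
    distinct indices give distinct lines. *)
Lemma triple_pointsP P :
  triple_points (arrangement a b) P <-> size (lines_through P) = 3%N.
Proof.
rewrite /triple_points /=.
have -> : [set l | arrangement a b l /\ l P] = ell a b @` [set` lines_through P].
  apply/seteqP; split=> [_ [[k /= kl <-] kP]|_ [k /= + <-]].
    exists k => //=; rewrite mem_filter mem_iota.
    by rewrite asboolT.
  rewrite mem_filter mem_iota => /andP[/asboolP kP kl].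
  by split => //; exists k.
have card_through : ell a b @` [set` lines_through P] #= `I_(size (lines_through P)).
  apply: card_eq_trans (card_seq (filter_uniq _ (iota_uniq _ _))).
  apply: inj_card_eq => i j; rewrite !inE /= !mem_filter.
  move=> /andP[_ il] /andP[_ jl] eq_ij; apply/eqP.
  by apply: contraT => /(ell_neq il jl).
split=> [c3|s3]; last by rewrite -s3.
apply/esym/card_eq_II; apply: card_eq_trans card_through.
by rewrite card_eq_sym.
Qed.

Lemma triples_lines_through P :
  triple_points (arrangement a b) P -> lines_through P \in triples.
Proof.
move=> /triple_pointsP; set s := lines_through P => s3.
have sl k : k \in s -> k \in lines /\ ell a b k P.
  by rewrite mem_filter => /andP[/asboolP].
(* The increasing order brings the list under [coll_triples]. *)
have: sorted ltn s by apply: sorted_filter; [exact: ltn_trans|exact: iota_ltn_sorted].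
case: s s3 sl => [|i [|j [|k [|]]]] //= _ sl /and3P[ij jk _].
have [|il iP] := sl i; first by rewrite !inE eqxx.
have [|jl jP] := sl j; first by rewrite !inE eqxx orbT.
have [|kl kP] := sl k; first by rewrite !inE eqxx !orbT.
have := allP (allP (allP coll_triples i il) j jl) k kl.
rewrite ij jk => /eqP <-; apply/concurrent_coll => //.
- by rewrite ltn_eqF.
- by rewrite ltn_eqF // (ltn_trans ij).
- by rewrite ltn_eqF.
- by exists P.
Qed.

Lemma lines_through_triples t : t \in triples ->
  exists P, lines_through P = t.
Proof.
move=> tT; have := allP triples_wf t tT; have := allP triples_no_fourth t tT.
case: t tT => [|i [|j [|k [|]]]] // tT.
move=> /allP no_fourth /and5P[il jl kl /andP[ij jk] /eqP t_filter].
have := allP (allP (allP coll_triples i il) j jl) k kl.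
have ik := ltn_trans ij jk.
rewrite ij jk tT => /eqP cijk.
have [P [[iP jP] kP]] : concurrent (ell a b i) (ell a b j) (ell a b k).
  by apply/concurrent_coll; rewrite ?cijk ?ltn_eqF.
exists P; rewrite -t_filter; apply: eq_in_filter => l ll.
apply/asboolP/idP => [lP|]; last by rewrite !inE => /or3P[]/eqP->.
have := no_fourth l ll; case: (boolP (l \in _)) => //; rewrite orFb => lt.
move: (lt); rewrite !inE !negb_or => /and3P[li lj lk] /negP[].
apply/concurrent_coll; rewrite 1?[_ == l]eq_sym // ?ltn_eqF //.
by exists P.
Qed.

(** Two of the three lines already determine the point. *)
Lemma lines_through_inj :
  {in triple_points (arrangement a b) &, injective lines_through}.
Proof.
move=> P Q; rewrite !inE => tP _ eqPQ.
have sl R k : k \in lines_through R -> k \in lines /\ ell a b k R.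
  by rewrite mem_filter => /andP[/asboolP].
have := allP triples_wf _ (triples_lines_through tP).
have := sl Q; rewrite -eqPQ; have := sl P.
case: (lines_through P) => [|i [|j [|k [|]]]] // slP slQ /and5P[_ _ _ /andP[ij _] _].
have [|il iP] := slP i; first by rewrite !inE eqxx.
have [|jl jP] := slP j; first by rewrite !inE eqxx orbT.
have [|_ iQ] := slQ i; first by rewrite !inE eqxx.
have [|_ jQ] := slQ j; first by rewrite !inE eqxx orbT.
by apply: ell_meet_unique il jl _ iP jP iQ jQ; rewrite ltn_eqF.
Qed.

(** The predicate serves both counts: always true for the total, membership of k for the points on
    line k. *)
Lemma card_triple_points (p : pred (seq nat)) :
  triple_points (arrangement a b) `&` [set P | p (lines_through P)] #=
  `I_(count p triples).
Proof.
rewrite -size_filter.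
apply: card_eq_trans (card_seq (filter_uniq p (isT : uniq triples))).
rewrite card_eq_sym.
have -> : [set` [seq t <- triples | p t]] = lines_through @`
    (triple_points (arrangement a b) `&` [set P | p (lines_through P)]).
  apply/seteqP; split=> [t|_ [P [tP pP] <-]]; rewrite /mkset mem_filter.
    move=> /andP[pt tT]; have [P Pt] := lines_through_triples tT.
    exists P => //; split; last by rewrite /mkset Pt.
    apply/triple_pointsP; rewrite Pt.
    by have := allP triples_wf t tT; case: t {pt tT Pt} => [|? [|? [|? [|]]]].
  by apply/andP; split; [exact: pP|exact: triples_lines_through].
apply: inj_card_eq => P Q; rewrite !inE /= => -[tP _] [tQ _].
by apply: lines_through_inj; rewrite inE.
Qed.

Lemma card_triple_points_on k : k \in lines ->
  triple_points (arrangement a b) `&` ell a b k #=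
  `I_(count (fun t => k \in t) triples).
Proof.
move=> kl; have := card_triple_points (fun t => k \in t).
congr (is_true (_ `&` _ #= _)); apply/seteqP; split=> P /=;
  by rewrite mem_lines_through // => /asboolP.
Qed.

End Incidence.

(** * The six concurrences and the counts of triple points *)

Theorem mainTheorem1 (R : realType) (a b : R[i])
    (ha0 : a != 0) (ha1 : a != 1) (hb1 : b != 1) (hab : a != b) :
  ((concurrent (ell a b 1) (ell a b 10) (ell a b 11) /\
    concurrent (ell a b 1) (ell a b 12) (ell a b 13)) /\
   [/\ concurrent (ell a b 8) (ell a b 10) (ell a b 13) <-> C13 a b = 0,
       concurrent (ell a b 7) (ell a b 13) (ell a b 11) <-> C13 a b = 0,
       concurrent (ell a b 9) (ell a b 12) (ell a b 11) <-> C13 a b = 0 &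
       concurrent (ell a b 12) (ell a b 10) (ell a b 6) <-> C13 a b = 0])
  /\
  (C13 a b = 0 ->
   [/\ forall i j : nat, (1 <= i <= 13)%N -> (1 <= j <= 13)%N -> i != j ->
         ell a b i <> ell a b j,
       triple_points (arrangement a b) #= `I_22,
       triple_points (arrangement a b) `&` ell a b 1 #= `I_6 &
       forall k : nat, (2 <= k <= 13)%N ->
         triple_points (arrangement a b) `&` ell a b k #= `I_5]).
Proof.
have oppr0P (x : R[i]) : - x = 0 <-> x = 0.
  by split=> [/eqP|->]; rewrite ?oppr0 // oppr_eq0 => /eqP.
split; [split; [split|split]|move=> hC; split].
(* These two determinants vanish identically in a and b. *)
1,2: by apply/concurrent_ell; rewrite /det3 /=; ring.
1-4: rewrite concurrent_ell.
- have -> : det3 (ell_form a b 8) (ell_form a b 10) (ell_form a b 13) = C13 a b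
    by rewrite /det3 /C13 /=; ring.
  by [].
- have -> : det3 (ell_form a b 7) (ell_form a b 13) (ell_form a b 11) = - C13 a b
    by rewrite /det3 /C13 /=; ring.
  exact: oppr0P.
- have -> : det3 (ell_form a b 9) (ell_form a b 12) (ell_form a b 11) = - C13 a b
    by rewrite /det3 /C13 /=; ring.
  exact: oppr0P.
- have -> : det3 (ell_form a b 12) (ell_form a b 10) (ell_form a b 6) = - C13 a b
    by rewrite /det3 /C13 /=; ring.
  exact: oppr0P.
- by move=> i j i13 j13 ij; apply: ell_neq; rewrite // mem_iota.
- have := card_triple_points ha0 ha1 hC predT.
  by congr (is_true (_ #= _)); apply/seteqP; split=> [P []|P].
- exact: (card_triple_points_on ha0 ha1 hC (isT : 1%N \in lines)).
- move=> k /andP[k2 k13].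
  have kl : k \in iota 2 12 by rewrite mem_iota k2.
  have := card_triple_points_on ha0 ha1 hC (k := k).
  have /allP/(_ k kl)/eqP -> :
    all (fun k => count (fun t => k \in t) triples == 5%N) (iota 2 12) by [].
  by apply; rewrite mem_iota (ltnW k2).
Qed.
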